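(* Let $\delta>0$ and let $\mu$ be a probability distribution on a finite set of points $Z\subset\mathbb{R}$. Then there is a shift-invariant one-sample estimator that is optimal. Furthermore, if all of the pairwise distances between points of $Z$ are distinct (that is, distinct two-element subsets $\{z,z'\}$ of $Z$ have distinct distances $|z-z'|$), then for every integer $n\ge 1$ there is a shift-invariant $n$-sample estimator that is optimal.
   Context: For $\theta\in\mathbb{R}$, $\mu_\theta(A)=\mu(\{x:x+\theta\in A\})$, and $\mu_\theta^n$ is the product measure $\mu_\theta\times\cdots\times\mu_\theta$ on $\mathbb{R}^n$. An $n$-sample estimator is a (Borel) measurable function $e:\mathbb{R}^n\to\mathbb{R}$. Its ($\delta$-)quality is $Q(e)=\inf_{\theta\in\mathbb{R}}\mu_\theta^n(\{\mathbf{x}\in\mathbb{R}^n:|e(\mathbf{x})-\theta|<\delta\})$. It is shift-invariant if $e(x_1+c,\ldots,x_n+c)=e(x_1,\ldots,x_n)+c$ for all $c,x_i\in\mathbb{R}$. It is optimal (for the fixed $\delta$ and $n$) if $Q(e)\ge Q(e')$ for all $n$-sample estimators $e'$. *)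

(* Defs.v *)
From HB Require Import structures.
From mathcomp Require Import all_boot all_order all_algebra.
From mathcomp Require Import all_classical all_reals all_analysis measurable_realfun.

Set Implicit Arguments.
Unset Strict Implicit.
Unset Printing Implicit Defensive.

Import Order.TTheory GRing.Theory Num.Theory.
Import numFieldNormedType.Exports.

Local Open Scope classical_set_scope.
Local Open Scope ring_scope.

Section product_power.
Context d (T : measurableType d) (R : realType).

Definition tuple_cons n (p : T * n.-tuple T) : n.+1.-tuple T :=
  [tuple of p.1 :: p.2].

Let measurable_tuple_cons n : measurable_fun [set: T * n.-tuple T] (@tuple_cons n).
Proof. exact: measurable_cons. Qed.

HB.instance Definition _ n :=
  @isMeasurableFun.Build _ _ _ _ (@tuple_cons n) (@measurable_tuple_cons n).

(* The n-fold product measure P x ... x P: the binary product of P with its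
   n-fold power, transported along T * T^n ~ T^(n+1).  The measurable sets of
   [n.-tuple T] are the product sigma-algebra. *)
Fixpoint product_power (P : probability T R) n : probability (n.-tuple T) R :=
  if n is m.+1 then distribution (P \x product_power P m)%E (@tuple_cons m)
  else dirac ([tuple] : 0.-tuple T).

Lemma product_powerE (P : probability T R) n (A : 'I_n -> set T) :
  (forall i, measurable (A i)) ->
  product_power P n [set x | forall i, A i (tnth x i)] =
  (\prod_(i < n) P (A i))%E.
Proof.
elim: n A => [|n IHn] A mA /=.
  rewrite big_ord0 diracE mem_set//= => i; by case: i.
rewrite big_ord_recl -IHn//.
have mrect m (B : 'I_m -> set T) : (forall i, measurable (B i)) ->
    measurable [set x : m.-tuple T | forall i, B i (tnth x i)].
  move=> mB.
  rewrite (_ : [set x | _] = \bigcap_(i in [set: 'I_m])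
    ((fun x : m.-tuple T => tnth x i) @^-1` B i)); last first.
    by apply/seteqP; split=> x /= h i; [move=> _|]; exact: h.
  apply: fin_bigcap_measurable => // i _.
  by rewrite -[X in measurable X]setTI; exact: measurable_tnth (mB i).
rewrite -product_measure1E//; last first.
  by apply: (mrect n (fun i => A (lift ord0 i))) => i; exact: mA.
rewrite /distribution /pushforward; congr (_ _).
apply/seteqP; split=> -[x t] /=.
  by move=> h; split=> [|i]; [have := h ord0|have := h (lift ord0 i)];
    rewrite /tuple_cons /= ?tnth0 ?tnthS.
move=> [h0 hS] i; have [j ->|->] := unliftP ord0 i.
  by rewrite /tuple_cons tnthS; exact: hS.
by rewrite /tuple_cons tnth0.
Qed.

End product_power.

Section estimators.
Context (R : realType).
Implicit Types (mu : probability R R) (theta delta : R) (n : nat) (Z : set R).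

Let measurable_shift theta : measurable_fun [set: R] (shift theta).
Proof. exact: measurable_funD. Qed.

HB.instance Definition _ theta :=
  @isMeasurableFun.Build _ _ _ _ (shift theta) (measurable_shift theta).

Definition shifted mu theta : probability R R := distribution mu (shift theta).

Lemma shiftedE mu theta (A : set R) :
  shifted mu theta A = mu [set x | A (x + theta)].
Proof. by []. Qed.

Definition estimator n := {mfun n.-tuple R >-> R}.

Definition quality mu delta n (e : estimator n) : \bar R :=
  ereal_inf [set product_power (shifted mu theta) n
                   [set x | `|e x - theta| < delta] | theta in [set: R]].

Definition shift_invariant n (e : estimator n) : Prop :=
  forall (c : R) (x : n.-tuple R), e [tuple tnth x i + c | i < n] = e x + c.

Definition optimal mu delta n (e : estimator n) : Prop :=
  forall e' : estimator n, (quality mu delta e' <= quality mu delta e)%E.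

Definition distinct_distances Z : Prop :=
  forall a b c d : R, Z a -> Z b -> Z c -> Z d -> a <> b -> c <> d ->
    [set a; b] <> [set c; d] -> `|a - b| <> `|c - d|.

End estimators.

(* Main.v *)
Require Import Defs.
From HB Require Import structures.
From mathcomp Require Import all_boot all_order all_algebra.
From mathcomp Require Import all_classical all_reals all_analysis measurable_realfun.
From mathcomp Require Import lra.

(** Let [z] enumerate the support, [p i] the mass of [z i], and
    [nu i = p i ^+ n].  A sample of size [n] with shift [theta] either consists
    of [n] equal values [z i + theta], which happens with probability [nu i], or
    is not constant.  When distances in the support are distinct, the differences
    within a non-constant sample identify the support points it comes from, so
    that [theta] is recovered exactly; for [n = 1] every sample is constant.
    What remains in both cases is to estimate [theta] from the value [y] of a
    constant sample.  A shift-invariant rule answers [y - c] and succeeds exactly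
    when [z i] is in the open window of radius [delta] around [c].  Take [c] so
    that the [nu]-mass of this window is maximal ([window_mass_max]).  The
    resulting estimator [locate] has success probability at least [value], that
    is, 1 minus the [nu]-mass outside the best window, whatever [theta] is.

    No estimator does better in the worst case.  On constant samples an arbitrary
    estimator is a rule [g], and a fixed observed value [y] is explained by the
    shifts [y - z i]; the rule is right for precisely those [i] with [z i] in the
    window around [y - g y], hence for a set of [nu]-mass at most that of the best
    window.  Averaging over shifts transfers this bound per observed value to a
    bound per shift.  As no uniform distribution on the shifts exists, the average
    runs over the sums [\sum_i z i *+ k i] with [k] in the box [{0, .., N-1}^I]:
    the values [y] that occur then lie in the image of the box of side [N + 1],
    which is larger by a factor that tends to 1 ([sum_box_hits],
    [exists_shift_few_hits]).  The box is a set of exponents, so coincidences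
    among the sums, due to additive relations between the [z i], do no harm. *)

Import Order.TTheory GRing.Theory Num.Theory.
Import numFieldNormedType.Exports.

Set Implicit Arguments.
Unset Strict Implicit.
Unset Printing Implicit Defensive.

Local Open Scope classical_set_scope.
Local Open Scope ring_scope.

(** * Windows and the averaging bound *)

Section windows.
Context (R : realType) (I : finType).
Implicit Types (z w : I -> R) (delta M : R) (N : nat).

Definition window_mass z w delta c := \sum_(i | `|z i - c| < delta) w i.

(** The mass of a window depends only on the set of indices it captures, so it
    takes finitely many values. *)
Lemma window_mass_max z w delta :
  exists c, forall c', window_mass z w delta c' <= window_mass z w delta c.
Proof.
pose captured c : {set I} := [set i | `|z i - c| < delta]%SET.
pose realized (A : {set I}) := `[< exists c, A = captured c >].
have massE c : window_mass z w delta c = \sum_(i in captured c) w i.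
  by apply: eq_bigl => i; rewrite inE.
have r0 : realized (captured 0) by apply/asboolP; exists 0.
case: (arg_maxP (fun A : {set I} => \sum_(i in A) w i) r0) => A.
move=> /asboolP[c ->] cmax.
by exists c => c'; rewrite !massE; apply: cmax; apply/asboolP; exists c'.
Qed.

Definition box_shift z N (k : {ffun I -> 'I_N}) : R := \sum_i z i *+ k i.

Definition box_step N (i : I) (k : {ffun I -> 'I_N}) : {ffun I -> 'I_N.+1} :=
  [ffun j => inord (k j + (j == i))].

Lemma box_stepE N i (k : {ffun I -> 'I_N}) j :
  box_step i k j = (k j + (j == i))%N :> nat.
Proof.
by rewrite ffunE inordK// ltnS (leq_trans _ (ltn_ord (k j)))// -addn1 leq_add2l leq_b1.
Qed.

Lemma box_step_inj N i : injective (@box_step N i).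
Proof.
move=> k k' kk'; apply/ffunP => j; apply/val_inj => /=.
by apply/eqP; rewrite -(eqn_add2r (j == i)) -!box_stepE kk'.
Qed.

Lemma box_shift_step z N i (k : {ffun I -> 'I_N}) :
  box_shift z (box_step i k) = z i + box_shift z k.
Proof.
rewrite /box_shift [in RHS](bigD1 i)//= [in LHS](bigD1 i)//= box_stepE eqxx addn1.
rewrite mulrS -addrA; congr (_ + (_ + _)); apply: eq_bigr => j ji.
by rewrite box_stepE (negbTE ji) addn0.
Qed.

(** The step is an injection of the box of side [N] into that of side [N + 1]. *)
Lemma sum_box_step N i (G : {ffun I -> 'I_N.+1} -> R) : (forall k, 0 <= G k) ->
  \sum_(k : {ffun I -> 'I_N}) G (box_step i k) <= \sum_k G k.
Proof.
move=> G0; rewrite [leRHS](bigID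
  [in [set box_step i k | k in [set: {ffun I -> 'I_N}]]%SET])/=.
rewrite big_imset/=; last by move=> x y _ _; exact: box_step_inj.
rewrite [X in _ <= X + _](eq_bigl xpredT) => [|k]; last by rewrite finset.inE.
by rewrite lerDl sumr_ge0.
Qed.

(** Double counting.  Observing [z i] under the shift of [k] produces the value
    attached to [box_step i k], so the successes of [g] can be collected according
    to the observed value instead of the shift.  For each value they form a
    window. *)
Lemma sum_box_hits z w delta M (g : R -> R) N :
  (forall i, 0 <= w i) -> (forall c, window_mass z w delta c <= M) ->
  \sum_(k : {ffun I -> 'I_N})
    \sum_(i | `|g (z i + box_shift z k) - box_shift z k| < delta) w i
  <= M * (N.+1 ^ #|I|)%:R.
Proof.
move=> w0 wM.
pose hit i (k : {ffun I -> 'I_N.+1}) :=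
  if `|z i - (box_shift z k - g (box_shift z k))| < delta then w i else 0.
have hitE (k : {ffun I -> 'I_N}) :
    \sum_(i | `|g (z i + box_shift z k) - box_shift z k| < delta) w i =
    \sum_i hit i (box_step i k).
  rewrite big_mkcond/=; apply: eq_bigr => i _; rewrite /hit box_shift_step.
  set b := box_shift z k; rewrite (_ : z i - _ = g (z i + b) - b)//; lra.
under eq_bigr do rewrite hitE.
rewrite exchange_big/=.
apply: (@le_trans _ _ (\sum_i \sum_k hit i k)).
  by apply: ler_sum => i _; apply: sum_box_step => k; rewrite /hit; case: ifP.
rewrite exchange_big/= mulr_natr.
have -> : (N.+1 ^ #|I|)%N = #|{ffun I -> 'I_N.+1}| by rewrite card_ffun card_ord.
rewrite -sumr_const; apply: ler_sum => k _.
by rewrite /hit -big_mkcond/=; exact: wM.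
Qed.

(** Bernoulli's inequality: the share of the smaller box in the larger one,
    [(1 - 1 / (N + 1)) ^+ m], tends to 1. *)
Lemma exprBn_ge_linear (x : R) m : 0 <= x <= 1 -> 1 - x *+ m <= (1 - x) ^+ m.
Proof.
move=> /andP[x0 x1]; elim: m => [|m IH]; first by rewrite mulr0n subr0 expr0.
rewrite exprS mulrS; have : 0 <= x *+ m by rewrite mulrn_wge0.
nra.
Qed.

(** If every shift exceeded [M + eta], so would the average over a box; a box of
    large enough side contradicts the double counting. *)
Lemma exists_shift_few_hits z w delta M (g : R -> R) eta :
  (forall i, 0 <= w i) -> (forall c, window_mass z w delta c <= M) -> 0 < eta ->
  exists theta, \sum_(i | `|g (z i + theta) - theta| < delta) w i <= M + eta.
Proof.
move=> w0 wM eta0; apply: contrapT => /forallNP many.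
have M0 : 0 <= M by apply: le_trans (wM 0); apply: sumr_ge0.
set m := #|I|.
(* this size makes the relative loss at the boundary, at most m / (N + 2),
   cost less than eta *)
pose N := Num.truncn ((M + eta) *+ m / eta).
have box_le : (M + eta) * (N.+1 ^ m)%:R <= M * (N.+2 ^ m)%:R.
  apply: le_trans (sum_box_hits g N.+1 w0 wM).
  have -> : (N.+1 ^ m)%N = #|{ffun I -> 'I_N.+1}| by rewrite card_ffun card_ord.
  rewrite mulr_natr -sumr_const; apply: ler_sum => k _.
  by apply: ltW; rewrite ltNge; apply/negP/many.
have small : (M + eta) *+ m / N.+2%:R < eta.
  rewrite ltr_pdivrMr ?ltr0n// mulrC -ltr_pdivrMr//.
  by apply: lt_trans (truncnS_gt _) _; rewrite ltr_nat.
have := @exprBn_ge_linear N.+2%:R^-1 m.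
rewrite invr_ge0 ler0n invf_le1 ?ltr0n// ler1n => /(_ isT).
have -> : 1 - N.+2%:R^-1 = N.+1%:R / N.+2%:R :> R.
  apply: (mulIf (x := N.+2%:R)); first by rewrite pnatr_eq0.
  rewrite mulrBl mulVf ?pnatr_eq0// divfK ?pnatr_eq0// mul1r -[in LHS]natr1.
  by rewrite addrK.
rewrite expr_div_n -!natrX => bern.
have : (M + eta) * ((N.+1 ^ m)%:R / (N.+2 ^ m)%:R) <= M.
  by rewrite mulrA ler_pdivrMr// ltr0n expn_gt0.
move=> le1; have : (M + eta) * (1 - N.+2%:R^-1 *+ m) <= M.
  by apply: le_trans le1; rewrite ler_pM2l// ltr_wpDl.
rewrite mulrBr mulr1 mulrnAr -mulrnAl; move: small; set q := _ / _ => small; lra.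
Qed.

End windows.

(** * Laws with finite support and their samples *)

Lemma measurable_tuple_box d (T : measurableType d) n (A : 'I_n -> set T) :
  (forall k, measurable (A k)) ->
  measurable [set x : n.-tuple T | forall k, A k (tnth x k)].
Proof.
move=> mA; rewrite (_ : [set x | _] =
    \bigcap_(k in [set: 'I_n]) ((fun x : n.-tuple T => tnth x k) @^-1` A k)).
  apply: fin_bigcap_measurable => // k _.
  by rewrite -[X in measurable X]setTI; exact: measurable_tnth (mA k).
by apply/seteqP; split=> /= x xA k; [move=> _|]; exact: xA.
Qed.

Lemma measurable_fun_forallb d (T : measurableType d) (K : finType)
    (f : K -> T -> bool) : (forall k, measurable_fun [set: T] (f k)) ->
  measurable_fun [set: T] (fun x => [forall k, f k x]).
Proof.
move=> mf; apply: (measurable_fun_bool true); rewrite setTI.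
rewrite (_ : _ @^-1` _ = \bigcap_(k in [set: K]) (f k @^-1` [set true])).
  apply: fin_bigcap_measurable => // k _.
  by rewrite -[X in measurable X]setTI; exact: mf.
apply/seteqP; split=> [x /forallP xf k _|x xf]; first exact: xf.
by apply/forallP => k; exact: xf.
Qed.

Section finitely_supported.
Context (R : realType) (mu : probability R R) (I : finType) (z : I -> R).
Hypotheses (z_inj : injective z) (mu_z : mu (range z) = 1%E).
Implicit Types (theta : R) (n : nat).

Definition mass i := fine (mu [set z i]).

Lemma shifted_point theta i : shifted mu theta [set z i + theta] = (mass i)%:E.
Proof.
rewrite shiftedE (_ : [set x | _] = [set z i]).
  by rewrite /mass fineK// fin_num_measure.
by apply/seteqP; split=> x /= => [/addIr|->].
Qed.

Definition constant_samples theta n (P : pred I) : set (n.-tuple R) :=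
  [set x | exists2 i, P i & forall k, tnth x k = z i + theta].

Arguments constant_samples theta n P : clear implicits.

Lemma constant_samplesE theta n (P : pred I) : constant_samples theta n P =
  \bigcup_(i in [set` P]) [set x | forall k, [set z i + theta] (tnth x k)].
Proof. by []. Qed.

Lemma measurable_constant_samples theta n P : measurable (constant_samples theta n P).
Proof.
rewrite constant_samplesE; apply: fin_bigcup_measurable => // i _.
by apply: (measurable_tuple_box (A := fun=> [set z i + theta])).
Qed.

Lemma prob_constant_samples theta n P :
  product_power (shifted mu theta) n.+1 (constant_samples theta n.+1 P) =
  (\sum_(i | P i) mass i ^+ n.+1)%:E.
Proof.
rewrite constant_samplesE measure_fin_bigcup//; first last.
- by move=> i _; apply: (measurable_tuple_box (A := fun=> [set z i + theta])).
- move=> i j _ _ [x [/(_ ord0)/= xi /(_ ord0)/=]].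
  by rewrite xi => /addIr/z_inj.
rewrite -(bigfs _ (r := index_enum I)) ?index_enum_uniq//; last first.
  by move=> i _; rewrite mem_index_enum.
rewrite -sumEFin; apply: eq_bigr => i _.
apply: (eq_trans (product_powerE _ (A := fun=> [set z i + theta]) _)) => [k|].
  exact: measurable_set1.
rewrite (eq_bigr (fun=> (mass i)%:E)) => [|k _]; last exact: shifted_point.
by rewrite prodEFin prodr_const card_ord.
Qed.

Definition samples theta n : set (n.-tuple R) :=
  [set x | forall k, exists i, tnth x k = z i + theta].

Arguments samples theta n : clear implicits.

Lemma measurable_shifted_range theta : measurable [set y | exists i, y = z i + theta].
Proof.
rewrite (_ : [set y | _] = \bigcup_(i in [set: I]) [set z i + theta]).
  by apply: fin_bigcup_measurable => // i _; exact: measurable_set1.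
by apply/seteqP; split=> y /= [i]; [exists i | exists i].
Qed.

Lemma prob_samples theta n : product_power (shifted mu theta) n (samples theta n) = 1%E.
Proof.
rewrite (product_powerE _ (A := fun=> [set y | exists i, y = z i + theta])) => [|k].
  apply: big1 => k _; rewrite shiftedE -mu_z; congr (mu _).
  apply/seteqP; split=> y /= => [[i /addIr ->]|[i _ <-]]; first by exists i.
  by exists i.
exact: measurable_shifted_range.
Qed.

Lemma measurable_samples theta n : measurable (samples theta n).
Proof.
apply: (measurable_tuple_box (A := fun=> [set y | exists i, y = z i + theta])) => k.
exact: measurable_shifted_range.
Qed.

Definition hits delta theta n (e : estimator R n) : set (n.-tuple R) :=
  [set x | `|e x - theta| < delta].

Lemma measurable_hits delta theta n (e : estimator R n) : measurable (hits delta theta e).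
Proof.
have mlt : measurable_fun [set: n.-tuple R] (fun x => `|e x - theta| < delta).
  apply: (measurable_fun_ltr (g := cst delta)); last exact: measurable_cst.
  by apply: measurableT_comp => //; apply: measurable_funB.
by rewrite -[hits _ _ _]setTI; exact: (mlt measurableT [set true]).
Qed.

(** Used to bound the success of an estimator from above: [P] selects the constant
    samples on which it fails. *)
Lemma prob_avoiding_le theta n (A : set (n.+1.-tuple R)) P :
  measurable A -> A `&` constant_samples theta n.+1 P = set0 ->
  (product_power (shifted mu theta) n.+1 A <=
   (1 - \sum_(i | P i) mass i ^+ n.+1)%:E)%E.
Proof.
move=> mA /disjoints_subset AP; rewrite EFinB -(prob_constant_samples theta).
have mP := measurable_constant_samples theta (n := n.+1) P.
rewrite -probability_setC//; apply: le_measure => //; rewrite inE//.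
exact: measurableC.
Qed.

(** Used to bound the success of an estimator from below: almost every sample takes
    its values in the shifted support, so only failures on such samples matter. *)
Lemma prob_missing_ge theta n (A : set (n.+1.-tuple R)) P :
  measurable A -> samples theta n.+1 `&` ~` A `<=` constant_samples theta n.+1 P ->
  ((1 - \sum_(i | P i) mass i ^+ n.+1)%:E <=
   product_power (shifted mu theta) n.+1 A)%E.
Proof.
move=> mA AP; have mP := measurable_constant_samples theta (n := n.+1) P.
have mS := measurable_samples theta (n := n.+1).
rewrite EFinB -(prob_constant_samples theta) -{1}(prob_samples theta n.+1).
rewrite leeBlDr ?fin_num_measure//; apply: le_trans (measureU2 _ mA mP).
apply: le_measure; rewrite ?inE//; first exact: measurableU.
by move=> x Sx; have [Ax|nAx] := pselect (A x); [left|right; apply: AP].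
Qed.

End finitely_supported.

(** * The shift-invariant estimator *)

Section locate.
Context (R : realType) (I : finType) (z : I -> R).
Implicit Types (c theta : R) (n : nat).

Definition all_equal n (x : n.+1.-tuple R) := [forall k, tnth x k == tnth x ord0].

Definition same_shape n (x : n.+1.-tuple R) (t : {ffun 'I_n.+1 -> I}) :=
  [forall k, tnth x k - tnth x ord0 == z (t k) - z (t ord0)].

(** A non-constant configuration of support points is determined by its shape. *)
Definition rigid n := forall t u : {ffun 'I_n.+1 -> I},
  (exists k, t k != t ord0) ->
  (forall k, z (t k) - z (t ord0) = z (u k) - z (u ord0)) -> u = t.

(** On a non-constant sample with support configuration [t], the sum has [t] as its
    only index when [z] is rigid, and the value is the exact shift.  The sum stands
    for a choice of [t] because it is measurable in [x] and makes sense, and is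
    shift-invariant, for every [x]. *)
Definition locate c n (x : n.+1.-tuple R) : R :=
  tnth x ord0 - (if all_equal x then c else \sum_(t | same_shape x t) z (t ord0)).

Lemma measurable_locate c n : measurable_fun [set: n.+1.-tuple R] (@locate c n).
Proof.
apply: measurable_funB; first exact: measurable_tnth.
apply: measurable_fun_ifT => //.
  apply: measurable_fun_forallb => k.
  by apply: measurable_fun_eqr; exact: measurable_tnth.
under eq_fun do rewrite big_mkcond/=.
apply: measurable_sum => t; apply: measurable_fun_ifT => //.
apply: measurable_fun_forallb => k.
apply: measurable_fun_eqr; last exact: measurable_cst.
by apply: measurable_funB; exact: measurable_tnth.
Qed.

HB.instance Definition _ c n :=
  @isMeasurableFun.Build _ _ _ _ (@locate c n) (@measurable_locate c n).

Lemma locate_shift_invariant c n :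
  @shift_invariant R n.+1 (@locate c n : estimator R n.+1).
Proof.
move=> b x; rewrite /= /locate !tnth_mktuple addrAC; congr (_ - _ + _).
have -> : all_equal [tuple tnth x i + b | i < n.+1] = all_equal x.
  by apply: eq_forallb => k; rewrite !tnth_mktuple (inj_eq (addIr b)).
case: ifP => // _; apply: eq_bigl => t; apply: eq_forallb => k.
by rewrite !tnth_mktuple opprD addrACA subrr addr0.
Qed.

Lemma locate_all_equal c n (x : n.+1.-tuple R) :
  all_equal x -> locate c x = tnth x ord0 - c.
Proof. by rewrite /locate => ->. Qed.

Lemma locate_exact c theta n (x : n.+1.-tuple R) (t : {ffun 'I_n.+1 -> I}) :
  rigid n -> (forall k, tnth x k = z (t k) + theta) -> ~~ all_equal x ->
  locate c x = theta.
Proof.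
move=> rig xt neq; rewrite /locate (negbTE neq) (big_pred1 t) => [|u].
  by rewrite xt addrC addKr.
apply/forallP/eqP => [/= shape|->] => [|k]; last by rewrite !xt opprD addrACA subrr addr0.
apply: rig => [|k]; last by rewrite -(eqP (shape k)) !xt opprD addrACA subrr addr0.
move: neq; rewrite negb_forall => /existsP[k]; rewrite !xt => tk.
by exists k; apply: contraNneq tk => ->.
Qed.

End locate.

(** * Optimality *)

(** Both qualities are compared with [value], one minus the probability of a constant
    sample that comes from outside the best window.  It is a lower bound for the
    success probability of [locate] at every shift and, up to [eta], an upper bound
    for that of [e'] at the shift given by averaging. *)
Lemma rigid_optimal (R : realType) (mu : probability R R) (I : finType)
    (z : I -> R) (delta : R) n :
  injective z -> mu (range z) = 1%E -> 0 < delta -> rigid z n ->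
  exists e : estimator R n.+1, shift_invariant e /\ optimal mu delta e.
Proof.
move=> z_inj mu_z delta0 rig.
pose nu i := mass mu z i ^+ n.+1.
have nu0 i : 0 <= nu i by rewrite exprn_ge0// fine_ge0.
have [c cmax] := window_mass_max z nu delta.
exists (@locate _ _ z c n); split=> [|e']; first exact: locate_shift_invariant.
pose value := 1 - \sum_(i | ~~ (`|z i - c| < delta)) nu i.
apply: (@le_trans _ _ value%:E).
  apply/lee_addgt0Pr => eta eta0.
  (* the rule that e' follows on constant samples is e' \o diag *)
  pose diag y : n.+1.-tuple R := [tuple y | _ < n.+1].
  have [theta few] := exists_shift_few_hits (fun y => e' (diag y)) nu0 cmax eta0.
  apply: ge_ereal_inf.
  exists (product_power (shifted mu theta) n.+1 (hits delta theta e')).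
    by exists theta.
  pose miss i := ~~ (`|e' (diag (z i + theta)) - theta| < delta).
  apply: le_trans (prob_avoiding_le mu z_inj (P := miss) _ _) _.
  - exact: measurable_hits.
  - apply/disjoints_subset => x hx [i /negP mi xi]; apply: mi.
    rewrite (_ : diag _ = x)//; apply: eq_from_tnth => k.
    by rewrite tnth_mktuple xi.
  rewrite lee_fin /value.
  have split_nu (Q : pred I) : \sum_(i | ~~ Q i) nu i = \sum_i nu i - \sum_(i | Q i) nu i.
    by rewrite [in RHS](bigID Q)/= addrAC subrr add0r.
  rewrite /miss !split_nu; move: few; rewrite /window_mass; lra.
apply: le_ereal_inf_tmp => _ [theta _ <-].
apply: (prob_missing_ge z_inj mu_z); first exact: (@measurable_hits _ delta theta n.+1).
move=> x [xs /= nhit].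
have [t xt] := choice xs.
have xt' k : tnth x k = z ([ffun k => t k] k) + theta by rewrite ffunE xt.
have [eqx|neqx] := boolP (all_equal x); last first.
  by case: nhit; rewrite (locate_exact c rig xt' neqx) subrr normr0.
exists (t ord0) => [|k]; last by rewrite (eqP (forallP eqx k)) xt.
apply/negP => hit; apply: nhit; rewrite locate_all_equal// xt.
by rewrite (_ : _ - _ - _ = z (t ord0) - c)//; lra.
Qed.

Lemma rigid_one (R : realType) (I : finType) (z : I -> R) : rigid z 0.
Proof. by move=> t u [k]; rewrite (ord1 k) eqxx. Qed.

(** A nonzero difference has its end points determined up to exchange, by the
    distance, and exchanging them would change its sign. *)
Lemma rigid_distinct_distances (R : realType) (I : finType) (z : I -> R) n :
  injective z -> distinct_distances (range z) -> rigid z n.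
Proof.
move=> z_inj dd t u [k tk] shape.
have step j : t j != t ord0 -> u j = t j /\ u ord0 = t ord0.
  move=> tj; have zt : z (t j) <> z (t ord0) by move=> /z_inj/eqP; exact/negP.
  have zu : z (u j) <> z (u ord0).
    by move=> E; apply: zt; apply/eqP; rewrite -subr_eq0 shape E subrr.
  have [E|NE] := pselect ([set z (t j); z (t ord0)] = [set z (u j); z (u ord0)]).
    have [] : [set z (t j); z (t ord0)] (z (u j)) by rewrite E; left.
      move=> /= ej; split; first exact: z_inj.
      by apply: z_inj; move: (shape j); rewrite ej => /addrI/oppr_inj.
    move=> /= ej.
    have [|e0] : [set z (t j); z (t ord0)] (z (u ord0)) by rewrite E; right.
      (* the exchanged case: the difference would equal its opposite *)
      move=> /= e0; exfalso; apply: zt; move: (shape j); rewrite ej e0; lra.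
    by case: zu; rewrite ej e0.
  (* distinct pairs at the same distance *)
  by exfalso; apply: (dd _ _ _ _ _ _ _ _ zt zu NE); rewrite ?shape//; exists.
have [_ u0] := step k tk.
apply/ffunP => j; have [tj|/step[]//] := eqVneq (t j) (t ord0).
rewrite tj; apply: z_inj; move: (shape j); rewrite tj subrr u0.
by move/esym/eqP; rewrite subr_eq0 => /eqP.
Qed.

Theorem mainTheorem5 (R : realType) (delta : R) (mu : probability R R)
    (Z : set R) (hdelta : 0 < delta) (hZ : finite_set Z)
    (hmu : mu Z = 1%E) :
  (exists e : estimator R 1, shift_invariant e /\ optimal mu delta e) /\
  (distinct_distances Z ->
   forall n : nat, (1 <= n)%N ->
   exists e : estimator R n, shift_invariant e /\ optimal mu delta e).
Proof.
have /finite_seqP[s Zs] := hZ.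
pose z (i : seq_sub s) := val i.
have z_inj : injective z := val_inj.
have Zz : Z = range z.
  rewrite Zs; apply/seteqP; split=> [y ys|_ [i _ <-]]; last exact: valP.
  by exists (SeqSub ys).
rewrite Zz in hmu *; split.
  exact: (rigid_optimal z_inj hmu hdelta (@rigid_one _ _ z)).
move=> dd [//|n] _; apply: (rigid_optimal z_inj hmu hdelta).
exact: rigid_distinct_distances.
Qed.
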